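(* For every positive integer $k$, every caterpillar is $k$-special. Hence every caterpillar $G$ of order $n$ satisfies $b_k(G) \leq \left\lceil \frac{n}{k} \right\rceil + k$.
   Context: All graphs are finite, simple and undirected. A caterpillar is a tree that becomes a path when all of its leaves are removed. A graph $G$ on $n$ vertices is $k$-special if $V(G)$ can be partitioned into sets $S_1,\dots,S_{\lceil n/k\rceil}$, all of cardinality $k$ with at most one exception, such that each $S_i$ has diameter at most $k$ with respect to distance in $G$ (i.e. $d_G(u,v)\le k$ for all $u,v\in S_i$). $k$-liminal burning game on $G$ ($k$ a positive integer): two players, Saboteur and Arsonist. Each vertex is burned or unburned, and revealed or unrevealed; initially all are unburned and unrevealed. In each round: (i) propagation: every unburned vertex with a neighbor burned in an earlier round becomes burned (whether revealed or not); (ii) the Saboteur reveals $k$ vertices that are unrevealed and unburned (all such vertices if fewer than $k$ exist); revealed vertices stay revealed; (iii) the Arsonist burns one revealed unburned vertex (revealed in this or any earlier round), if one exists. The game ends in the round in which all vertices are burned. The Saboteur maximizes and the Arsonist minimizes the number of rounds; $b_k(G)$ is the number of rounds under optimal play. *)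

(* Defs.v *)
From mathcomp Require Import all_boot.

Set Implicit Arguments.
Unset Strict Implicit.
Unset Printing Implicit Defensive.

(* A finite simple graph is a symmetric irreflexive [e : rel T] on a finType. *)

Section Graphs.
Variables (T : finType) (e : rel T).

Definition connected : Prop := 0 < #|T| /\ forall x y : T, connect e x y.

Definition acyclic : Prop := forall c : seq T, 2 < size c -> ~ ucycle e c.

Definition tree : Prop := connected /\ acyclic.

Definition leaf (x : T) : bool := #|[set y | e x y]| == 1.

(* The subgraph induced on [A] is a path.  The path without vertices is       *)
(* allowed, so that the tree on two vertices (both leaves) is a caterpillar.  *)
Definition induces_path (A : {set T}) : Prop :=
  exists s : seq T,
    [/\ uniq s, s =i A &
        {in A &, forall x y, e x y = (index y s == (index x s).+1)
                                  || (index x s == (index y s).+1)}].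

Definition caterpillar : Prop := tree /\ induces_path [set x | ~~ leaf x].

(* The distance is a functional relation rather than a function: there is no  *)
(* [d] with [distance u v d] when [u] and [v] are not connected.              *)
Definition distance (u v : T) (d : nat) : Prop :=
  (exists p : seq T, [/\ path e u p, last u p = v & size p = d]) /\
  (forall p : seq T, path e u p -> last u p = v -> d <= size p).

Definition diameter_le (k : nat) (A : {set T}) : Prop :=
  {in A &, forall u v, exists2 d, distance u v d & d <= k}.

Definition ceil_div (n k : nat) : nat := (n + k.-1) %/ k.

(* [partition] asks for nonempty blocks, which the cardinality constraints    *)
(* force anyway.                                                              *)
Definition special (k : nat) : Prop :=
  exists P : {set {set T}},
    [/\ partition P [set: T],
        #|P| = ceil_div #|T| k,
        #|[set A in P | #|A| != k]| <= 1 &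
        {in P, forall A, diameter_le k A}].

(* A position between two rounds is the pair of the set [B] of burned         *)
(* vertices and the set [R] of revealed ones.                                 *)

Definition propagate (B : {set T}) : {set T} :=
  B :|: [set x | [exists y in B, e y x]].

Definition reveal_moves (k : nat) (B R : {set T}) : {set {set T}} :=
  let U := ~: (B :|: R) in
  [set D : {set T} | (D \subset U) && (#|D| == minn k #|U|)].

(* The burned sets that the Arsonist can reach. *)
Definition burn_moves (B R : {set T}) : {set {set T}} :=
  if R :\: B == set0 then [set B] else [set v |: B | v in R :\: B].

(* Minimax number of further rounds in the game that is stopped after [N]     *)
(* rounds if it has not ended by then.  The default value [N'] of the minimum *)
(* is irrelevant: there is always a move, and its value is at most [N'].      *)
Fixpoint rounds (k N : nat) (B R : {set T}) : nat :=
  if B == setT then 0 else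
  if N is N'.+1 then
    let B' := propagate B in
    (\max_(D in reveal_moves k B' R)
       \big[minn/N']_(B'' in burn_moves B' (R :|: D))
          rounds k N' B'' (R :|: D)).+1
  else 0.

(* For [0 < k] at least one vertex is burned in every round, so that stopping *)
(* after [#|T|] rounds does not affect the game; see [rounds_stable].         *)
Definition burning_number (k : nat) : nat := rounds k #|T| set0 set0.

Lemma leq_bigminn (I : finType) (A : {set I}) (F : I -> nat) (N m : nat) :
  reflect (m <= N /\ {in A, forall i, m <= F i})
          (m <= \big[minn/N]_(i in A) F i).
Proof.
rewrite (big_morph (leq m) (leq_min m) (erefl (m <= N))).
apply: (iffP idP) => [|[le_mN le_mF]].
  case: (boolP (m <= N)) => [_|_]; last first.
    by elim/big_rec: _ => // i b _ ab0 /andP[_ /ab0[]].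
  by rewrite big_andE => /forall_inP.
by rewrite le_mN big_andE; apply/forall_inP.
Qed.

Lemma bigminn_dflt (I : finType) (A : {set I}) (F : I -> nat) (M N : nat) :
    A != set0 -> {in A, forall i, F i <= N} -> N <= M ->
  \big[minn/M]_(i in A) F i = \big[minn/N]_(i in A) F i.
Proof.
move=> /set0Pn[i0 Ai0] leF leNM; apply/eqP; rewrite eqn_leq.
apply/andP; split; apply/leq_bigminn.
  have /leq_bigminn[_ leA] := leqnn (\big[minn/M]_(i in A) F i).
  by split=> //; apply: leq_trans (leA _ Ai0) (leF _ Ai0).
have /leq_bigminn[leN leA] := leqnn (\big[minn/N]_(i in A) F i).
by split=> //; apply: leq_trans leNM.
Qed.

Lemma rounds_le (k N : nat) (B R : {set T}) : rounds k N B R <= N.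
Proof.
case: N => [|N] /=; case: ifP => // _; rewrite ltnS.
apply/bigmax_leqP=> D _; set m := \big[minn/N]_(_ in _) _.
by have: m <= m by []; rewrite {2}/m => /leq_bigminn[].
Qed.

Lemma burn_moves_neq0 (B R : {set T}) : burn_moves B R != set0.
Proof.
rewrite /burn_moves; case: ifP => [_|/negbT/set0Pn[v Av]]; apply/set0Pn.
  by exists B; rewrite inE.
by exists (v |: B); apply: imset_f.
Qed.

Lemma burn_moves_proper (k : nat) (B R D B2 : {set T}) :
    0 < k -> B != setT -> D \in reveal_moves k (propagate B) R ->
  B2 \in burn_moves (propagate B) (R :|: D) -> B \proper B2.
Proof.
move=> k_gt0 BT; have sBB' : B \subset propagate B by apply: subsetUl.
move: (propagate B) sBB' => B' sBB'; rewrite inE => /andP[sDU /eqP cardD].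
rewrite /burn_moves; case: ifPn => [RD0|_]; last first.
  case/imsetP=> v; rewrite inE => /andP[vB' _] ->; rewrite properE.
  rewrite (subset_trans sBB' (subsetU1 _ _)) /=.
  by apply: contra vB' => /subset_trans/(_ sBB')/subsetP->; rewrite ?setU11.
rewrite inE => /eqP->; rewrite properE sBB' /=.
apply: contra BT => sB'B; rewrite -subTset; apply: subset_trans sB'B.
move: RD0; rewrite setD_eq0 subUset => /andP[sRB' sDB'].
have D0 : D = set0.
  apply/eqP; rewrite -subset0 -(setICr B') subsetI sDB'.
  by apply: subset_trans sDU _; rewrite setCS subsetUl.
have U0 : ~: (B' :|: R) = set0.
  apply/eqP; rewrite -cards_eq0; move: cardD.
  by rewrite D0 cards0 /minn; case: ltnP => _ E; rewrite -E // in k_gt0 *.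
by rewrite -(setUidPl sRB') -(setCK (_ :|: _)) U0 setC0.
Qed.

Lemma rounds_stable (k N : nat) (B R : {set T}) :
  0 < k -> #|~: B| <= N -> rounds k N B R = rounds k #|~: B| B R.
Proof.
move=> k_gt0; suff stepN M B1 R1 :
    #|~: B1| <= M -> rounds k M.+1 B1 R1 = rounds k M B1 R1.
  by move=> /subnK<-; elim: (N - _) => // m <-; rewrite addSn stepN ?leq_addl.
elim: M B1 R1 => [|M IHM] B1 R1 leB.
  have /eqP B1C : ~: B1 == set0 by rewrite -cards_eq0 -leqn0.
  by rewrite /= -[B1]setCK B1C setC0 eqxx.
rewrite [LHS]/= [RHS]/=; case: ifPn => // B1T; congr _.+1.
apply: eq_bigr => D Dmove.
have eqF B2 : B2 \in burn_moves (propagate B1) (R1 :|: D) ->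
    rounds k M.+1 B2 (R1 :|: D) = rounds k M B2 (R1 :|: D).
  move=> /(burn_moves_proper k_gt0 B1T Dmove) ltB; apply: IHM.
  by rewrite -ltnS; apply: leq_trans leB; apply: proper_card; rewrite properC.
rewrite -[RHS](bigminn_dflt (burn_moves_neq0 _ _) _ (leqnSn M)); last first.
  by move=> B2 _; apply: rounds_le.
by apply: eq_bigr => B2 /eqF.
Qed.

End Graphs.

(* Main.v *)
(* List the vertices of a caterpillar along its spine v_1, v_2, ..., each v_i
   being followed by the leaves attached to it.  Two vertices at positions i < j
   of this list are at distance at most j - i + 1, so cutting the list into
   consecutive blocks of length k shows that the caterpillar is k-special.  In
   the game on a k-special graph, the Arsonist burns as long as possible a vertex
   in a part that has no burned vertex yet: t rounds reveal t * k vertices, which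
   are too many for t - 1 parts, so after n / k (rounded up) rounds each part
   contains a burned vertex, and k further propagations burn everything. *)
Require Import Defs.
From mathcomp Require Import all_boot zify.

Set Implicit Arguments.
Unset Strict Implicit.
Unset Printing Implicit Defensive.

Lemma ltn_ceil_div (n k j : nat) : 0 < k -> (j < ceil_div n k) = (j * k < n).
Proof. by move=> k_gt0; rewrite leq_divRL // mulSn; lia. Qed.

Lemma leq_ceil_div (n k : nat) : 0 < k -> n <= ceil_div n k * k.
Proof. by move=> k_gt0; rewrite leqNgt -ltn_ceil_div // ltnn. Qed.

Section Graph.
Variables (T : finType) (e : rel T).

(** * Walks of bounded length *)

(** Upper bounds on distances, phrased with arbitrary walks so that they compose without any
    minimality argument. *)
Definition within (d : nat) (x y : T) : Prop :=
  exists p, [/\ path e x p, last x p = y & size p <= d].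

Lemma within_refl d x : within d x x.
Proof. by exists [::]. Qed.

Lemma within1 x y : e x y -> within 1 x y.
Proof. by move=> exy; exists [:: y]; rewrite /= exy. Qed.

Lemma within_trans d1 d2 y x z :
  within d1 x y -> within d2 y z -> within (d1 + d2) x z.
Proof.
move=> [p [ep <- led1]] [q [eq <- led2]]; exists (p ++ q).
by rewrite cat_path last_cat size_cat ep leq_add.
Qed.

Lemma within_leq d1 d2 x y : d1 <= d2 -> within d1 x y -> within d2 x y.
Proof.
by move=> led [p [ep lp szp]]; exists p; split=> //; apply: leq_trans led.
Qed.

Lemma within_sym d x y : symmetric e -> within d x y -> within d y x.
Proof.
move=> e_sym [p [ep <- led]]; exists (rev (belast x p)); split.
- by rewrite rev_path (eq_path (e' := e)) // => u v; rewrite e_sym.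
- by case: p {ep led} => //= y' p; rewrite rev_cons last_rcons.
- by rewrite size_rev size_belast.
Qed.

Lemma within_distance k x y :
  within k x y -> exists2 d, distance e x y d & d <= k.
Proof.
move=> [p [ep lp lek]].
(* Tuples of fixed length form a finite type, so [walk] is boolean and has a least witness. *)
pose walk n := [exists q : n.-tuple T, path e x q && (last x q == y)].
have walkP q : path e x q -> last x q = y -> walk (size q).
  by move=> eq lq; apply/existsP; exists (in_tuple q); rewrite eq lq eqxx.
have ex_walk : exists n, walk n by exists (size p); apply: walkP.
case: (ex_minnP ex_walk) => d /existsP[q /andP[eq /eqP lq]] min_d.
exists d; last by apply: leq_trans lek; apply/min_d/walkP.
split=> [|r er lr]; first by exists q; rewrite size_tuple.
exact/min_d/walkP.
Qed.

(** * Distances along a spine with attached leaves *)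

Section Anchors.
Variable p : T -> T.

(* [p] sends each vertex to its attachment point on the spine: [b] follows [a]
   when [b] is the next spine vertex, or a leaf with the same attachment. *)
Definition follows : rel T :=
  [rel a b | (p b == b) && e (p a) b || (p b == p a) && e (p b) b].

(** Each step of [follows] costs at most one edge: the anchor moves to the next spine vertex or
    stays put. Starting from [p a] instead of [a] lets the induction ignore the leaves in
    between. *)
Lemma path_follows_within a b s :
  path follows a (rcons s b) -> within (size s).+1 (p a) b.
Proof.
elim: s a => [|c s IHs] a /= => [/andP[+ _]|/andP[fac /IHs wcb]].
  by case/orP=> /andP[/eqP pb eab]; apply: within1; rewrite // -pb.
case/orP: fac => /andP[/eqP pc eac]; last first.
  by rewrite -pc; apply: within_leq wcb.
by apply: (within_trans (d1 := 1) _ wcb); apply: within1; rewrite pc.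
Qed.

Hypothesis e_sym : symmetric e.
Hypothesis p_near : forall x, within 1 x (p x).

Lemma sorted_follows_within k s :
  sorted follows s -> size s <= k -> {in s &, forall u v, within k u v}.
Proof.
elim: s => //= a s IHs fs ltk.
have wa v : v \in s -> within k a v.
  move=> vs; case/splitPr: vs fs ltk {IHs} => s1 s2 + ltk.
  rewrite -cat_rcons cat_path => /andP[/path_follows_within wav _].
  (* One edge from [a] to [p a], then one per position: if [v] comes [j] places after [a], the cost
     is [j + 1], and [j < k]. *)
  apply: within_leq (within_trans (p_near a) wav).
  by rewrite size_cat /= in ltk; lia.
move=> u v; rewrite !inE => /predU1P[->|us] /predU1P[->|vs].
- exact: within_refl.
- exact: wa.
- by apply: within_sym => //; apply: wa.
- by apply: IHs => //; [apply: path_sorted fs | apply: ltnW].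
Qed.

End Anchors.

(** * Partitions obtained by cutting an enumeration of the vertices *)

Lemma within_blocks_special k (s : seq T) : 0 < k -> uniq s -> s =i T ->
    (forall i, {in take k (drop (i * k) s) &, forall u v, within k u v}) ->
  special e k.
Proof.
move=> k_gt0 s_uniq sT sW; set m := ceil_div #|T| k.
have szs : size s = #|T| by rewrite -(card_uniqP s_uniq) (eq_card sT).
pose B (j : 'I_m) := [set x in take k (drop (j * k) s)].
have cardB j : #|B j| = minn k (#|T| - j * k).
  rewrite cardsE (card_uniqP _) ?take_uniq ?drop_uniq //.
  by rewrite size_take_min size_drop szs.
(* A member determines the index of its block; injectivity of [B] and disjointness of the blocks
   both follow. *)
have memB x (j : 'I_m) : x \in B j -> index x s %/ k = j.
  rewrite inE => xB; have xd := mem_take xB.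
  move: xB; rewrite in_take // => ltk.
  have -> : index x s = j * k + index x (drop (j * k) s).
    have xs := s_uniq; rewrite -[s in index x s](cat_take_drop (j * k)).
    rewrite -[s](cat_take_drop (j * k)) cat_uniq in xs.
    case/and3P: xs => _ /hasPn/(_ _ xd)/negPf xnt _.
    rewrite index_cat xnt size_takel // szs ltnW // -ltn_ceil_div //.
  by rewrite divnMDl // divn_small ?addn0.
have B0 (j : 'I_m) : B j != set0.
  have := ltn_ord j; rewrite -card_gt0 cardB ltn_ceil_div //; lia.
have B_inj : injective B.
  move=> i j eqB; have /set0Pn[x xi] := B0 i.
  by apply: val_inj; rewrite /= -(memB _ _ xi); apply: memB; rewrite -eqB.
exists [set B j | j : 'I_m]; split; last 1 first.
- by move=> _ /imsetP[j _ ->] u v;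
  rewrite !inE => us vs; apply/within_distance/(sW j).
- apply/and3P; split.
  + rewrite eqEsubset subsetT /=; apply/subsetP=> x _.
    have ltxs : index x s < #|T| by rewrite -szs index_mem sT.
    have ltm : index x s %/ k < m.
      by rewrite ltn_ceil_div //; apply: leq_ltn_trans (leq_divM _ _) ltxs.
    apply/bigcupP; exists (B (Ordinal ltm)); first exact: imset_f.
    rewrite inE /=; have xs : x \in s by rewrite sT.
    (* Within its block [x] has offset [index x s %% k], which is below [k], so [take k] keeps
       it. *)
    have dx : drop (index x s %/ k * k) s =
              take (index x s %% k) (drop (index x s %/ k * k) s) ++
              x :: drop (index x s).+1 s.
      rewrite -[LHS](cat_take_drop (index x s %% k)); congr (_ ++ _).
      by rewrite drop_drop addnC -divn_eq (drop_nth x) ?index_mem // nth_index.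
    rewrite dx take_cat size_takel ?size_drop; last first.
      by rewrite szs; move: ltxs (divn_eq (index x s) k); lia.
    have ltk := ltn_pmod (index x s) k_gt0.
    rewrite ltnNge (ltnW ltk) mem_cat.
    by move: ltk; rewrite -subn_gt0 => /prednK<-; rewrite /= inE eqxx orbT.
  + apply/trivIsetP=> _ _ /imsetP[i _ ->] /imsetP[j _ ->] ij.
    rewrite -setI_eq0; apply: contraNT ij => /set0Pn[x /setIP[xi xj]].
    by rewrite (inj_eq B_inj) -val_eqE /= -(memB _ _ xi) -(memB _ _ xj).
  + by apply/imsetP=> -[j _ /esym/eqP]; apply/negP.
- by rewrite card_imset // card_ord.
apply/card_le1_eqP=> A A'; rewrite !inE.
case/andP=> /imsetP[i _ ->] ki /andP[/imsetP[j _ ->] kj]; congr (B _).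
(* Every block before the last one is full. *)
suff last_block (l : 'I_m) : #|B l| != k -> l = m.-1 :> nat.
  by apply: val_inj; rewrite /= !last_block.
rewrite cardB => kl; have := ltn_ord l; case: (ltnP l.+1 m); last by lia.
rewrite ltn_ceil_div // mulSn => ltl; lia.
Qed.

(* The enumeration is v_1, leaves at v_1, v_2, leaves at v_2, ...: between two of
   its terms lie all the spine vertices between their attachment points. *)
Lemma dominating_path_special k (s : seq T) : symmetric e -> 0 < k ->
    uniq s -> sorted e s -> (forall x, x \notin s -> has (e x) s) ->
  special e k.
Proof.
move=> e_sym k_gt0 s_uniq es domin.
(* Off [s], the anchor is the first neighbour in [s]; by domination [find] succeeds and the default
   of [nth] is never reached. *)
pose p x := if x \in s then x else nth x s (find (e x) s).
have p_spine x : x \in s -> p x = x by rewrite /p => ->.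
have p_in x : p x \in s.
  by rewrite /p; case: ifPn => // /domin; rewrite has_find => ?; rewrite mem_nth.
have p_adj x : x \notin s -> e x (p x).
  by move=> xs; rewrite /p (negPf xs); apply/nth_find/domin.
pose fan v := [seq x <- enum T | (x \notin s) && (p x == v)].
have mem_fan x v : (x \in fan v) = (x \notin s) && (p x == v).
  by rewrite mem_filter mem_enum andbT.
pose comb := fix comb t := if t is v :: t' then v :: fan v ++ comb t' else [::].
have p_comb t x : {subset t <= s} -> x \in comb t -> p x \in t.
  elim: t => //= v t IHt ts; rewrite !inE mem_cat mem_fan.
  case/or3P=> [/eqP->|/andP[_ ->] //|/IHt->]; rewrite ?orbT //.
    by rewrite p_spine ?eqxx ?ts ?mem_head.
  by move=> y yt; rewrite ts // inE yt orbT.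
have uniq_comb t : {subset t <= s} -> uniq t -> uniq (comb t).
  elim: t => //= v t IHt ts /andP[vt ut].
  have ts' : {subset t <= s} by move=> y yt; rewrite ts // inE yt orbT.
  have vs : v \in s by rewrite ts ?mem_head.
  rewrite cat_uniq IHt // filter_uniq ?enum_uniq // mem_cat mem_fan vs !andbT /=.
  apply/andP; split.
    by apply: contra vt => /(p_comb _ _ ts'); rewrite p_spine.
  apply/hasPn=> x /(p_comb _ _ ts') xt.
  by apply: contra vt; rewrite mem_fan => /andP[_ /eqP<-].
(* The vertex just before [t] is the last leaf of [F], or [a] if [F] is empty; hence the
   quantification over all [b] anchored at [v]. *)
have path_fan v F t a : (forall b, p b = v -> path (follows p) b t) ->
    {subset F <= fan v} -> p a = v -> path (follows p) a (F ++ t).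
  move=> vt; elim: F a => [|b F IHF] a sF pa /=; first exact: vt.
  have := sF b (mem_head _ _); rewrite mem_fan => /andP[bs /eqP pb].
  have eb : e (p b) b by rewrite e_sym p_adj.
  rewrite /follows /= eb pb pa eqxx orbT /=.
  by apply: IHF => // c cF; rewrite sF // inE cF orbT.
have sorted_comb v t a : {subset v :: t <= s} -> path e v t -> p a = v ->
    path (follows p) a (fan v ++ comb t).
  elim: t v a => [|w t IHt] v a ts et pa; apply: path_fan (pa) => // b pb.
  have ws : w \in s by rewrite ts // !inE eqxx orbT.
  case/andP: et => evw et; rewrite /follows /= p_spine // eqxx pb evw /=.
  by apply: IHt; rewrite ?p_spine // => y yt; rewrite ts // inE yt orbT.
have combT : comb s =i T.
  move=> x; rewrite [RHS]inE.
  suff memt t : p x \in t -> x \in comb t by apply: memt.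
  elim: t => //= v t IHt; rewrite !inE mem_cat mem_fan.
  case/predU1P=> [pv|/IHt->]; last by rewrite !orbT.
  by rewrite -pv eqxx andbT /p; case: ifP => //; rewrite ?eqxx ?orbT.
apply: within_blocks_special k_gt0 (uniq_comb s _ s_uniq) combT _ => // i.
apply: (sorted_follows_within (p := p)) => //.
- move=> x; case xs: (x \in s); first by rewrite p_spine //; apply: within_refl.
  by apply/within1/p_adj; rewrite xs.
- apply/take_sorted/drop_sorted.
  suff sorted_t t : {subset t <= s} -> sorted e t -> sorted (follows p) (comb t).
    exact: sorted_t.
  case: t => //= v t ts et; apply: sorted_comb et _ => //.
  by rewrite p_spine ?ts ?mem_head.
- by rewrite size_take_min geq_minl.
Qed.

(** * The spine of a caterpillar as a dominating path *)

(** Each of the two leaves is the only neighbour of the other, so the pair is closed under adjacency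
    and, by connectedness, exhausts the graph. *)
Lemma adjacent_leaves x y : connected e -> symmetric e ->
  leaf e x -> leaf e y -> e x y -> forall z, (z == x) || (z == y).
Proof.
move=> [_ conn] e_sym /cards1P[x' ex] /cards1P[y' ey] exy z.
have nx w : e x w = (w == y).
  have := in_set1 y x'; rewrite -ex inE exy => /esym/eqP->.
  by rewrite -in_set1 -ex inE.
have ny w : e y w = (w == x).
  have := in_set1 x y'; rewrite -ey inE e_sym exy => /esym/eqP->.
  by rewrite -in_set1 -ey inE.
have cl : closed e (pred2 x y).
  apply: intro_closed => // [|u v euv /pred2P[]uE]; first exact: sym_connect_sym.
    by move: euv; rewrite uE nx inE => ->; rewrite orbT.
  by move: euv; rewrite uE ny inE => ->.
by have := closed_connect cl (conn x z); rewrite !inE eqxx => <-.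
Qed.

(* On two vertices the spine is empty, and any single vertex dominates. *)
Lemma caterpillar_dominating_path : symmetric e -> caterpillar e ->
  exists s, [/\ uniq s, sorted e s & forall x, x \notin s -> has (e x) s].
Proof.
move=> e_sym [[conn _] [s [s_uniq sE es]]].
have leafE x : x \notin s -> leaf e x by rewrite sE inE negbK.
have nbr x : leaf e x -> exists y, e x y.
  by case/cards1P=> y /setP/(_ y); rewrite !inE eqxx => exy; exists y.
case: (s =P [::]) => [s0|/eqP s0].
  case: (conn) => /card_gt0P[x _] _; exists [:: x]; split=> // z; rewrite inE => zx.
  have lf u : leaf e u by apply: leafE; rewrite s0.
  have [y exy] := nbr x (lf x).
  have := adjacent_leaves conn e_sym (lf x) (lf y) exy z.
  by rewrite (negPf zx) => /eqP->; rewrite /= e_sym exy.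
exists s; split=> // [|x xs].
  case: s s_uniq {leafE s0} sE es => // a s s_uniq sE es.
  apply/(sortedP a) => i lti; rewrite es -?sE ?mem_nth ?(ltnW lti) //.
  by rewrite !index_uniq ?eqxx // ltnW.
have [y exy] := nbr x (leafE x xs).
apply/hasP; case ys: (y \in s); first by exists y.
case: s s0 xs ys {s_uniq sE es} leafE => // a s _ xs ys leafE.
(* If [y] were off the spine too, the leaves [x] and [y] would be the whole graph, leaving no room
   for [a]. *)
have := adjacent_leaves conn e_sym (leafE x xs) (leafE y (negbT ys)) exy a.
by case/orP=> /eqP aE; rewrite aE mem_head in xs ys.
Qed.

(** * The burning game *)

Lemma burn_moves_sub (B B2 R : {set T}) : B2 \in burn_moves B R -> B \subset B2.
Proof.
rewrite /burn_moves; case: ifP => _; first by rewrite inE => /eqP->.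
by case/imsetP=> v _ ->; apply: subsetUr.
Qed.

(** Whatever the players do, propagation alone brings the burned set one step closer to every vertex
    in each round. *)
Lemma rounds_within k N d (B R : {set T}) :
  (forall x, exists2 b, b \in B & within d b x) -> rounds e k N B R <= d.
Proof.
elim: d N B R => [|d IHd] N B R near.
  suff -> : B = setT by case: N => [|N] /=; rewrite eqxx.
  apply/setP=> x; have [b bB [[|? ?] [_ bx]]] := near x; rewrite // inE.
  by rewrite /= in bx; rewrite -bx.
case: N => [|N] /=; case: ifP => // _; rewrite ltnS.
apply/bigmax_leqP=> D _.
have /set0Pn[B2 B2move] := burn_moves_neq0 (propagate e B) (R :|: D).
(* Reflexivity of [<=] at the minimum bounds it by its value at the move [B2]. *)
have /leq_bigminn[_ /(_ _ B2move)/leq_trans] :=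
  leqnn (\big[minn/N]_(i in burn_moves (propagate e B) (R :|: D))
     rounds e k N i (R :|: D)); apply; apply: IHd => x.
have sB2 := burn_moves_sub B2move.
have [b bB [[|c p] [/= ep bx szp]]] := near x.
  by exists b; [apply: (subsetP sB2); rewrite inE bB | exists [::]].
case/andP: ep => ebc ep; exists c; last by exists p.
apply: (subsetP sB2); rewrite !inE; apply/orP; right.
by apply/existsP; exists b; rewrite bB.
Qed.

(** The number of touched parts measures the progress of the Arsonist. *)
Definition touched (P : {set {set T}}) (B : {set T}) : {set {set T}} :=
  [set A in P | A :&: B != set0].

Lemma touchedS P (B B' : {set T}) : B \subset B' -> touched P B \subset touched P B'.
Proof.
move=> sB; apply/subsetP=> A; rewrite !inE => /andP[-> /=].
by apply: contraNneq => AB0; rewrite -subset0 -AB0 setIS.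
Qed.

(* If only [t] parts are touched, they cover at most [t * k] vertices, so some
   revealed vertex lies in an untouched part. *)
Lemma burn_touch k t P (B R : {set T}) :
    partition P [set: T] -> {in P, forall A : {set T}, #|A| <= k} ->
    t < #|P| -> t <= #|touched P B| -> B :|: R = setT \/ t.+1 * k <= #|R| ->
    0 < k ->
  exists2 B2, B2 \in burn_moves B R & t < #|touched P B2|.
Proof.
move=> partP cardP ltP leB BR k_gt0; case: (ltnP t #|touched P B|) => [ltB|geB].
  have /set0Pn[B2 B2m] := burn_moves_neq0 B R; exists B2 => //.
  by apply: leq_trans ltB _; apply/subset_leq_card/touchedS/(burn_moves_sub B2m).
have {leB geB} tB : #|touched P B| = t by apply/eqP; rewrite eqn_leq geB.
suff [A [AP AB [v vA vR]]] : exists A, [/\ A \in P, A :&: B = set0 &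
    exists2 v, v \in A & v \in R].
  have vB : v \notin B.
    by apply/negP=> vB; have := in_set0 v; rewrite -AB inE vA vB.
  exists (v |: B).
    have vRB : v \in R :\: B by rewrite inE vB.
    rewrite /burn_moves ifN; first exact: imset_f.
    by apply/set0Pn; exists v.
  rewrite -tB; apply: proper_card; rewrite properE touchedS ?subsetUr //=.
  apply/subsetPn; exists A; rewrite inE AP ?AB ?eqxx //=.
  by apply/set0Pn; exists v; rewrite !inE vA eqxx.
(* When every vertex is burned or revealed, any untouched part will do: its vertices are unburned,
   hence revealed. *)
case: BR => [BRT|leR].
  have : ~~ (P \subset touched P B).
    by apply: contraL ltP => /subset_leq_card; rewrite tB leqNgt.
  case/subsetPn=> A AP; rewrite inE AP negbK => /eqP AB; exists A; split=> //.
  have /set0Pn[v vA] : A != set0.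
    by case/and3P: partP => _ _; apply: contraNneq => <-.
  exists v => //; have := in_setT v; rewrite -BRT inE => /orP[vB|//].
  by have := in_set0 v; rewrite -AB inE vA vB.
have : ~~ (R \subset cover (touched P B)).
  apply: contraTN leR => /subset_leq_card leR; rewrite -ltnNge.
  apply: leq_ltn_trans leR _; apply: (@leq_ltn_trans (t * k)); last by lia.
  apply: leq_trans (leq_card_cover _) _; rewrite -tB -sum_nat_const.
  by apply: leq_sum => A; rewrite inE => /andP[/cardP].
case/subsetPn=> v vR vN; have : v \in cover P by rewrite (cover_partition partP).
case/bigcupP=> A AP vA; exists A; split=> //; last by exists v.
by apply: contraNeq vN => AB; apply/bigcupP; exists A; rewrite // inE AP.
Qed.

(** The two hypotheses involving [t] form the invariant of the first phase, in which each round
    raises [t] by one. The alternative [B :|: R = setT] takes over once the Saboteur has fewer than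
    [k] vertices left to reveal. *)
Lemma rounds_partition k N t P (B R : {set T}) : 0 < k ->
    partition P [set: T] ->
    {in P, forall A : {set T}, #|A| <= k /\ diameter_le e k A} ->
    t <= #|touched P B| -> B :|: R = setT \/ t * k <= #|R| ->
  rounds e k N B R <= #|P| - t + k.
Proof.
move=> k_gt0 partP HP; have [d] := ubnP (#|P| - t).
elim: d N t B R => // d IHd N t B R ltd leB BR.
case: (ltnP t #|P|) => [ltt|get].
  case: N => [|N] /=; case: ifP => // _.
  rewrite -(subSS t) subSn // addSn ltnS.
  apply/bigmax_leqP=> D; set B' := propagate e B; rewrite inE => /andP[sD /eqP cD].
  have sB : B \subset B' by apply: subsetUl.
  have BR' : B' :|: (R :|: D) = setT \/ t.+1 * k <= #|R :|: D|.
    case: (leqP k #|~: (B' :|: R)|) => [leU|ltU]; last first.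
      left; suff -> : D = ~: (B' :|: R) by rewrite setUA setUCr.
      by apply/eqP; rewrite eqEcard sD cD (minn_idPr (ltnW ltU)) leqnn.
    case: BR => [BRT|leR].
      have U0 : ~: (B' :|: R) = set0.
        by apply/eqP; rewrite -subset0 -setCT setCS -BRT setSU.
      by move: leU; rewrite U0 cards0 leqNgt k_gt0.
    right; rewrite cardsU disjoint_setI0 ?cards0 ?subn0; last first.
      rewrite disjoints_subset; apply: subset_trans (subsetUr B' R) _.
      by rewrite -setCS setCK.
    by rewrite cD (minn_idPl leU) mulSn addnC leq_add2r.
  have leB' : t <= #|touched P B'|.
    by apply: leq_trans leB _; apply/subset_leq_card/touchedS.
  have cardP : {in P, forall A : {set T}, #|A| <= k} by move=> A /HP[].
  have [B2 B2m ltB2] := burn_touch partP cardP ltt leB' BR' k_gt0.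
  set m := \big[minn/N]_(_ in _) _; have : m <= m by [].
  rewrite {2}/m => /leq_bigminn[_ /(_ _ B2m)/leq_trans]; apply.
  apply: IHd => //; first by lia.
  case: BR' => [BRT|]; [left | by right].
  by apply/eqP; rewrite -subTset -BRT setSU // (burn_moves_sub B2m).
(* Second phase: every part contains a burned vertex, which is within [k] of the whole part. *)
rewrite (eqP (get : #|P| - t == 0)) add0n; apply: rounds_within => x.
have touchE : touched P B = P.
  apply/eqP; rewrite eqEcard (leq_trans get leB) andbT.
  by apply/subsetP=> A; rewrite inE => /andP[].
have: x \in cover P by rewrite (cover_partition partP).
case/bigcupP=> A AP xA; have: A \in touched P B by rewrite touchE.
rewrite inE AP => /set0Pn[b /setIP[bA bB]]; exists b => //.
have [_ /(_ b x bA xA)[d' [[q [eq lq szq]] _] led']] := HP A AP.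
by exists q; rewrite szq.
Qed.

Lemma special_burning k : 0 < k -> special e k ->
  burning_number e k <= ceil_div #|T| k + k.
Proof.
move=> k_gt0 [P [partP cardP oneP diamP]]; rewrite -cardP -[#|P|]subn0.
apply: rounds_partition => //; last by right.
move=> A AP; split; last exact: diamP.
(* [special] puts no explicit bound on the exceptional part. The other [#|P|.-1] parts have [k]
   vertices each, and [#|T| <= #|P| * k] leaves at most [k] for [A]. *)
case: (eqVneq #|A| k) => [->//|Ak].
have cT := card_partition partP; rewrite cardsT (bigD1 A) //= in cT.
have := leq_ceil_div #|T| k_gt0; rewrite -cardP cT.
have -> : \sum_(A' in P | A' != A) #|A'| = #|P|.-1 * k.
  rewrite (cardsD1 A P) AP /= -sum_nat_const; apply: eq_big.
    by move=> A'; rewrite !inE andbC.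
  move=> A' /andP[A'P A'A].
  apply/eqP; apply: contraNT A'A => A'k.
  by apply/eqP/(card_le1_eqP oneP); rewrite inE ?A'P ?AP.
have : 0 < #|P| by apply/card_gt0P; exists A.
by case: #|P| => // m _; rewrite mulSn /=; lia.
Qed.

End Graph.

Theorem theorem18 (k : nat) (hk : 0 < k) (T : finType) (e : rel T)
    (e_sym : symmetric e) (e_irrefl : irreflexive e)
    (e_cat : caterpillar e) :
  special e k /\ burning_number e k <= ceil_div #|T| k + k.
Proof.
have [s [s_uniq es domin]] := caterpillar_dominating_path e_sym e_cat.
have special_e := dominating_path_special e_sym hk s_uniq es domin.
by split=> //; apply: special_burning.
Qed.
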